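(* Let $P(x,E)$ be a purely finitely additive sub-Markov kernel on an arbitrary discrete space $(X,\Sigma_d)$, and let $A$ be the sub-Markov operator generated by this kernel, $A\mu(E)=\int_X P(x,E)\,\mu(dx)$ for $\mu\in ba(X,\Sigma_d)$, $E\in\Sigma_d$. Then $A$ transforms all finitely additive measures into purely finitely additive measures, that is, $A[ba(X,\Sigma_d)]\subset pfa(X,\Sigma_d)$; in particular, $A[ca(X,\Sigma_d)]\subset pfa(X,\Sigma_d)$ and $A[pfa(X,\Sigma_d)]\subset pfa(X,\Sigma_d)$.
   Context: ''Arbitrary discrete space'' $(X,\Sigma_d)$: $X$ is an infinite set, $\Sigma_d=2^X$ is the sigma-algebra of all subsets of $X$, and the cardinality of $X$ is ''immeasurable'', meaning that every finite countably additive measure on $2^X$ that is zero on every one-point set is identically zero. $B(X,\Sigma_d)$ is the space of bounded $\Sigma_d$-measurable functions $X\to\mathbb R$. $ba(X,\Sigma_d)$ and $ca(X,\Sigma_d)$ are the spaces of bounded real-valued finitely additive, respectively countably additive, measures on $\Sigma_d$. A finitely additive measure $\mu\ge0$ is purely finitely additive if every countably additive measure $\lambda$ with $0\le\lambda\le\mu$ is identically zero; a signed measure is purely finitely additive if both components of its Jordan decomposition $\mu=\mu^+-\mu^-$ are. $pfa(X,\Sigma_d)$ is the space of bounded purely finitely additive measures (the zero measure counts as purely finitely additive). A purely finitely additive sub-Markov kernel is a function $P(x,E)$, $x\in X$, $E\in\Sigma_d$, with $0\le P(x,E)\le1$, $P(\cdot,E)\in B(X,\Sigma_d)$ for all $E$,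 and $P(x,\cdot)\in pfa(X,\Sigma_d)$ for all $x$. Integrals of bounded functions against bounded finitely additive measures are Radon integrals (the sup-norm continuous extension of the integral of simple functions). *)

(* Defs.v *)
From HB Require Import structures.
From mathcomp Require Import all_boot all_order all_algebra.
From mathcomp Require Import all_classical all_reals all_analysis.

Set Implicit Arguments.
Unset Strict Implicit.
Unset Printing Implicit Defensive.

Import Order.TTheory GRing.Theory Num.Theory.
Import numFieldNormedType.Exports HBSimple.

Local Open Scope classical_set_scope.
Local Open Scope ring_scope.

Section finitely_additive_measures.
Context d (X : measurableType d) (R : realType).

Definition bounded_measurable : set (X -> R) :=
  [set f : X -> R | measurable_fun [set: X] f /\ [bounded f x : R | x in [set: X]]].

(* Real-valued set functions are total on [set X]; only their values on the
   measurable sets matter. *)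
Definition ba : set (set X -> R) :=
  [set mu : set X -> R | [/\ mu set0 = 0, additive2 (EFin \o mu) &
    exists M : R, forall E, measurable E -> `|mu E| <= M]].

Definition ca : set (set X -> R) :=
  [set mu : set X -> R | ba mu /\ sigma_additive (EFin \o mu)].

Definition le_on_measurable (mu nu : set X -> R) : Prop :=
  forall E, measurable E -> mu E <= nu E.

(* For [mu] in [ba] the supremum is that of a nonempty bounded set. *)
Definition jordan_plus (mu : set X -> R) (E : set X) : R :=
  sup [set mu F | F in [set F | measurable F /\ F `<=` E]].

Definition jordan_minus (mu : set X -> R) (E : set X) : R :=
  - inf [set mu F | F in [set F | measurable F /\ F `<=` E]].

Definition purely_finitely_additive_ge0 (mu : set X -> R) : Prop :=
  forall lam, ca lam -> le_on_measurable (fun=> 0) lam ->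
    le_on_measurable lam mu -> forall E, measurable E -> lam E = 0.

Definition pfa : set (set X -> R) :=
  [set mu : set X -> R | [/\ ba mu, purely_finitely_additive_ge0 (jordan_plus mu) &
    purely_finitely_additive_ge0 (jordan_minus mu)]].

Definition sfun_uniform_nbhs (f : X -> R) : set_system {sfun X >-> R} :=
  filter_from [set e : R | 0 < e]
    (fun e => [set g : {sfun X >-> R} | forall x, `|f x - g x| <= e]).

(* Every bounded measurable function is a uniform limit of simple functions,
   and the integral of simple functions against [mu] in [ba] is Lipschitz for
   the sup norm; so the limit below exists for such [f] and [mu], and it is the
   value at [f] of the continuous extension. *)
Definition radon_integral (mu : set X -> R) (f : X -> R) : R :=
  lim ((fun g : {sfun X >-> R} => fine (sintegral (EFin \o mu) g))
         @ sfun_uniform_nbhs f).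

Definition pfa_sub_Markov_kernel (P : X -> set X -> R) : Prop :=
  [/\ forall x E, measurable E -> 0 <= P x E <= 1,
      forall E, measurable E -> bounded_measurable (P ^~ E) &
      forall x, pfa (P x)].

Definition sub_Markov_operator (P : X -> set X -> R) (mu : set X -> R)
    : set X -> R :=
  fun E => radon_integral mu (P ^~ E).

End finitely_additive_measures.

Arguments ba {d X R}.
Arguments ca {d X R}.
Arguments pfa {d X R}.

Definition immeasurable d (X : measurableType d) (R : realType) : Prop :=
  forall mu : {finite_measure set X -> \bar R},
    (forall x, mu [set x] = 0%E) -> forall E, measurable E -> mu E = 0%E.

Record arbitrary_discrete_space d (X : measurableType d) (R : realType)
    : Prop := {
  discrete_infinite : infinite_set [set: X] ;
  discrete_sigma_algebra : forall E : set X, measurable E ;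
  discrete_immeasurable : immeasurable X R }.

(* Main.v *)
Require Import Defs.
From HB Require Import structures.
From mathcomp Require Import all_boot all_order all_algebra.
From mathcomp Require Import all_classical all_reals all_analysis.
From mathcomp Require Import ring lra zify.
Set Implicit Arguments.
Unset Strict Implicit.
Unset Printing Implicit Defensive.

Local Open Scope classical_set_scope.

Import Order.TTheory GRing.Theory Num.Theory.
Import numFieldNormedType.Exports HBSimple.

(** On a discrete space of immeasurable cardinality, pure finite additivity can
be read off the points.  If [mu >= 0] is purely finitely additive, then the
point mass [mu [set y] * \d_y] is countably additive and lies below [mu], so
[mu [set y] = 0] ([pfa_ge0_set1]).  Conversely, if a bounded charge [mu]
vanishes at every point, so do both parts of its Jordan decomposition, because
the only subsets of [[set y]] are [set0] and [[set y]].  A countably additive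
measure between [0] and one of these parts vanishes at every point as well, and
is therefore zero by immeasurability ([pfa_set1_eq0]).

For the kernel this gives [P x [set y] = 0] for all [x] and [y].  Hence
[A mu [set y]], the integral of the zero function, is zero for every [y], and
[A mu] is purely finitely additive as soon as it is a bounded charge.

That last point requires the Radon integral to be additive and bounded.  Both
follow from one estimate on simple functions ([sintegral_addB_le]): if [f + g]
is within [e] of [k], then the integral of [f] plus that of [g] is within
[2 * M * e] of that of [k], where [M] bounds [|mu|].  To prove it, all three
integrals are written as sums over the common fibres of [(f, g, k)]; the total
mass [\sum |mu (fibre)|] is at most [2 * M], since the fibres of nonnegative
charge and those of negative charge each have a union of charge at most [M] in
absolute value.  With [g = 0] the estimate says that the integral is Lipschitz
for the sup norm, so the limit defining the Radon integral exists
([radon_integral_cvg]), and the estimates pass to this limit. *)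

(** * Integration against a bounded finitely additive measure *)

Section bounded_charge.
Context d (X : measurableType d) (R : realType).
Local Open Scope ring_scope.
Variables (mu : set X -> R) (M : R).
Hypotheses (mu0 : mu set0 = 0) (muU : additive2 (EFin \o mu)).
Hypothesis mu_le : forall E, measurable E -> `|mu E| <= M.

Lemma charge_bound_ge0 : 0 <= M.
Proof. exact: le_trans (normr_ge0 _) (mu_le measurable0). Qed.

Lemma preimage_mem_cons (T : eqType) (h : X -> T) (t : T) (s : seq T) :
  [set x | h x \in t :: s] = h @^-1` [set t] `|` [set x | h x \in s].
Proof.
apply/seteqP; split => x /=; rewrite in_cons.
  by case/orP => [/eqP|]; [left|right].
by case=> [->|->]; rewrite ?eqxx ?orbT.
Qed.

Lemma measurable_preimage_seq (T : eqType) (h : X -> T) (s : seq T) :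
  (forall t, measurable (h @^-1` [set t])) -> measurable [set x | h x \in s].
Proof.
move=> mh; elim: s => [|t s IHs].
  by rewrite (_ : [set x | _] = set0) //; apply/seteqP; split.
by rewrite preimage_mem_cons; exact: measurableU.
Qed.

Lemma mu_preimage_seq (T : eqType) (h : X -> T) (s : seq T) :
  (forall t, measurable (h @^-1` [set t])) -> uniq s ->
  mu [set x | h x \in s] = \sum_(t <- s) mu (h @^-1` [set t]).
Proof.
move=> mh; elim: s => [_|t s IHs /= /andP[ts us]].
  by rewrite big_nil (_ : [set x | _] = set0) //; apply/seteqP; split.
rewrite big_cons -IHs // preimage_mem_cons.
have disj : h @^-1` [set t] `&` [set x | h x \in s] = set0.
  by apply/seteqP; split => x //= -[->]; rewrite (negbTE ts).
by have [] := muU (mh t) (measurable_preimage_seq s mh) disj.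
Qed.

(** A finite form of the bound on the total variation: the fibres of
nonnegative charge have a union of charge at most [M], and those of negative
charge have a union of charge at least [- M]. *)
Lemma sum_abs_fibers_le (T : eqType) (h : X -> T) (s : seq T) :
  (forall t, measurable (h @^-1` [set t])) -> uniq s ->
  \sum_(t <- s) `|mu (h @^-1` [set t])| <= 2 * M.
Proof.
move=> mh us; pose p t := 0 <= mu (h @^-1` [set t]).
rewrite (bigID p) /=.
rewrite (eq_bigr (fun t => mu (h @^-1` [set t]))); last first.
  by move=> t pt; rewrite ger0_norm.
rewrite [X in _ + X](eq_bigr (fun t => - mu (h @^-1` [set t]))); last first.
  by move=> t pt; rewrite ltr0_norm // ltNge.
rewrite sumrN -!(big_filter s) -!mu_preimage_seq ?filter_uniq //.
set A := [set x | _]; set B := [set x | _].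
have := mu_le (@measurable_preimage_seq _ h [seq i <- s | p i] mh).
have := mu_le (@measurable_preimage_seq _ h [seq i <- s | ~~ p i] mh).
by rewrite -/A -/B !ler_norml => /andP[? ?] /andP[? ?]; lra.
Qed.

(** Change of variables.  It lets several simple functions be integrated over
one common partition of [X], whereas [sintegral] sums over the fibres of each
function separately. *)
Lemma sintegral_fibers (T : choiceType) (h : X -> T) (phi : T -> R) :
  finite_set (range h) -> (forall t, measurable (h @^-1` [set t])) ->
  fine (sintegral (EFin \o mu) (phi \o h)) =
  \sum_(t <- finmap.enum_fset (fset_set (range h)))
     phi t * mu (h @^-1` [set t]).
Proof.
move=> fh mh; set s := finmap.enum_fset _.
have s_uniq : uniq s by exact: finmap.fset_uniq.
have sP x : h x \in s by rewrite in_fset_set // inE; exists x.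
pose r := undup (map phi s).
have rP x : phi (h x) \in r by rewrite mem_undup map_f.
have fiberE y : mu ((phi \o h) @^-1` [set y]) =
    \sum_(t <- s | phi t == y) mu (h @^-1` [set t]).
  rewrite -big_filter -mu_preimage_seq ?filter_uniq //; congr (mu _).
  apply/seteqP; split => x /=; rewrite mem_filter sP andbT; by move/eqP.
rewrite sintegralET (fsbigE r) ?undup_uniq //; last first.
  move=> y _ yr; rewrite /= (_ : _ @^-1` _ = set0) ?mu0 ?mule0 //.
  by apply/seteqP; split => x //= xy; move: yr; rewrite -xy rP.
under eq_bigr do rewrite /= -EFinM.
rewrite sumEFin /=.
rewrite (eq_bigl xpredT); last by move=> y; rewrite in_setT.
under eq_bigr => y _ do rewrite fiberE big_distrr /=.
rewrite (exchange_big_dep xpredT) //=.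
rewrite big_seq [RHS]big_seq; apply: eq_bigr => t ts.
rewrite big_mkcond (bigD1_seq (phi t)) ?undup_uniq //=; last first.
  by rewrite mem_undup map_f.
rewrite eqxx big1 ?addr0 // => y /negbTE yt; by rewrite eq_sym yt.
Qed.

(** The one estimate behind both additivity and continuity.  On each nonempty
common fibre of [f], [g] and [k] the three functions are constant, with values
[a], [b], [c] such that [|a + b - c| <= e]; hence the left-hand side is at most
[e] times the total mass of the fibres. *)
Lemma sintegral_addB_le (f g k : {sfun X >-> R}) (e : R) :
  (forall x, `|f x + g x - k x| <= e) ->
  `|fine (sintegral (EFin \o mu) f) + fine (sintegral (EFin \o mu) g)
    - fine (sintegral (EFin \o mu) k)| <= 2 * M * e.
Proof.
move=> fgk_le; pose h x := (f x, g x, k x).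
have fh : finite_set (range h).
  apply: (@sub_finite_set _ _ ((range f `*` range g) `*` range k)).
    by move=> _ [x _ <-]; do 2?split; exists x.
  by do 2?apply: finite_setX; exact: fimfunP.
have mh t : measurable (h @^-1` [set t]).
  case: t => -[a b] c.
  rewrite (_ : _ @^-1` _ =
    f @^-1` [set a] `&` g @^-1` [set b] `&` k @^-1` [set c]).
    by do 2?apply: measurableI; exact: measurable_sfunP.
  by apply/seteqP; split => x /= => [[<- <- <-]|[[<- <-] <-]].
rewrite (@sintegral_fibers _ h (fun t => t.1.1) fh mh).
rewrite (@sintegral_fibers _ h (fun t => t.1.2) fh mh).
rewrite (@sintegral_fibers _ h (fun t => t.2) fh mh).
set s := finmap.enum_fset _; rewrite -big_split -sumrB /=.
under eq_bigr do rewrite -mulrDl -mulrBl.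
apply: le_trans (ler_norm_sum _ _ _) _.
have e_ge0 : 0 <= e by exact: le_trans (normr_ge0 _) (fgk_le point).
apply: (@le_trans _ _ (\sum_(t <- s) e * `|mu (h @^-1` [set t])|)).
  rewrite big_seq [leRHS]big_seq; apply: ler_sum => t ts.
  rewrite normrM ler_wpM2r //.
  move: ts; rewrite in_fset_set // inE => -[x _ <-]; exact: fgk_le.
rewrite -big_distrr /= mulrC ler_wpM2r //.
by apply: sum_abs_fibers_le => //; exact: finmap.fset_uniq.
Qed.

Lemma sintegral_sfun0 :
  fine (sintegral (EFin \o mu) (0 : {sfun X >-> R})) = 0.
Proof.
pose z := (fun=> 0) : X -> R.
rewrite (_ : fine _ = fine (sintegral (EFin \o mu) ((fun=> 0) \o z))) //.
rewrite sintegral_fibers ?big1 //= => [i _||].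
- by rewrite mul0r.
- by apply: (@sub_finite_set _ _ [set 0]) => //; move=> _ [x _ <-].
- by move=> t; rewrite preimage_cst; case: ifP.
Qed.

(** This is [sintegral_addB_le] with [g = 0]. *)
Lemma sintegral_dist_le (f k : {sfun X >-> R}) (e : R) :
  (forall x, `|f x - k x| <= e) ->
  `|fine (sintegral (EFin \o mu) f) - fine (sintegral (EFin \o mu) k)|
    <= 2 * M * e.
Proof.
move=> fk_le; rewrite -[X in `|X - _|]addr0 -sintegral_sfun0.
by apply: sintegral_addB_le => x; rewrite sfun0 /= addr0.
Qed.

(** Rounding [f x] down to a multiple of [e] moves it by less than [e], and it
takes finitely many values because [f] is bounded.  It is measurable because
rounding is monotone. *)
Lemma sfun_uniform_approx (f : X -> R) (e : R) :
  bounded_measurable f -> 0 < e ->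
  exists g : {sfun X >-> R}, forall x, `|f x - g x| <= e.
Proof.
move=> [mf [B [_ Bf]]] e_gt0.
pose q (y : R) : R := e * (Num.floor (y / e))%:~R.
have f_le x : `|f x| <= `|B| + 1.
  by apply: (Bf (`|B| + 1)) => //; rewrite (le_lt_trans (ler_norm _)) ?ltrDl.
have mg : measurable_fun [set: X] (q \o f).
  apply: measurableT_comp => //.
  apply: measurable_realfun.nondecreasing_measurable => // a b ab.
  by rewrite ler_pM2l // ler_int le_floor // ler_pM2r // invr_gt0.
have fg : finite_set (range (q \o f)).
  (* The rounded values are the [e * j] with [j] an integer in [[-N, N[]; [v]
     enumerates them. *)
  pose K := Num.floor ((`|B| + 1) / e).
  pose N := `|K|%N.+2.
  pose v (n : nat) : R := e * (n%:Z - N%:Z)%:~R.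
  apply: (@sub_finite_set _ _ (v @` `I_(N + N)%N)); last first.
    exact/finite_image/finite_II.
  move=> _ [x _ <-] /=.
  have := f_le x; rewrite ler_norml => /andP[].
  have B0 : 0 <= `|B| + 1 by apply: addr_ge0.
  have K0 : 0 <= K by rewrite floor_ge0 divr_ge0 // ltW.
  have KN : (K + 2 = N%:Z)%R by rewrite /N; lia.
  set n := Num.floor (f x / e) => lo hi.
  have nK : n <= K by apply: le_floor; rewrite ler_pM2r // invr_gt0.
  have nN : - (K + 1) <= n.
    rewrite -ltzD1 -(ltr_int R).
    apply: le_lt_trans (floorD1_gt _).
    rewrite intrN.
    have : (`|B| + 1) / e < (K + 1)%:~R by exact: floorD1_gt.
    have : - ((`|B| + 1) / e) <= f x / e.
      by rewrite -mulNr ler_pM2r // invr_gt0.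
    lra.
  exists (absz (n + N%:Z)); first by rewrite /=; lia.
  rewrite /v /q -/n; congr (_ * _%:~R); lia.
have sg : (q \o f) \in sfun by rewrite inE /=; apply/andP; split; rewrite inE.
exists (sfun_Sub sg) => x; rewrite sfun_valP /q /=.
set y := f x / e.
have -> : f x = e * y by rewrite /y; field; exact: lt0r_neq0.
rewrite -mulrBr normrM gtr0_norm // ler_piMr ?(ltW e_gt0) //.
have := floor_itv y; rewrite intrD => /andP[lo hi].
by rewrite ger0_norm; [lra|rewrite subr_ge0].
Qed.

Lemma sfun_uniform_nbhs_proper (f : X -> R) :
  bounded_measurable f -> ProperFilter (sfun_uniform_nbhs f).
Proof.
move=> bf; apply: filter_from_proper.
  apply: filter_from_filter; first by exists 1 => /=.
  move=> a b /= a0 b0; exists (Num.min a b); first by rewrite /= lt_min a0.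
  by move=> g /= gle; split => x; move: (gle x); rewrite le_min => /andP[].
by move=> e e_gt0; have [g ge] := sfun_uniform_approx bf e_gt0; exists g.
Qed.

(** The integrals of simple functions near [f] form a Cauchy filter, since two
functions within [e] of [f] are within [2 * e] of each other. *)
Lemma radon_integral_cvg (f : X -> R) : bounded_measurable f ->
  (fun g : {sfun X >-> R} => fine (sintegral (EFin \o mu) g))
    @ sfun_uniform_nbhs f --> radon_integral mu f.
Proof.
move=> bf; have PF := sfun_uniform_nbhs_proper bf.
apply: cauchy_cvg; apply: cauchy_exP => eps eps_gt0.
have M_ge0 := charge_bound_ge0.
(* The bound obtained is [4 * M * e]; the summand [1] makes the division safe
   when [M = 0] and the inequality strict. *)
pose e := eps / (4 * M + 1).
have e_gt0 : 0 < e by apply: divr_gt0 => //; lra.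
have [g0 g0e] := sfun_uniform_approx bf e_gt0.
exists (fine (sintegral (EFin \o mu) g0)); exists e => // g /= ge.
apply: (@le_lt_trans _ _ (2 * M * (2 * e))).
  apply: sintegral_dist_le => x.
  rewrite (_ : g0 x - g x = (f x - g x) - (f x - g0 x)); last by ring.
  by have := ler_normB (f x - g x) (f x - g0 x); have := ge x; have := g0e x; lra.
have -> : eps = (4 * M + 1) * e by rewrite /e; field; lra.
lra.
Qed.

(** Every simple approximation computes the integral with an explicit error;
the estimates below reduce to simple functions through this bound alone. *)
Lemma radon_integral_dist_le (f : X -> R) (g : {sfun X >-> R}) (e : R) :
  bounded_measurable f -> (forall x, `|f x - g x| <= e) ->
  `|radon_integral mu f - fine (sintegral (EFin \o mu) g)| <= 2 * M * e.
Proof.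
move=> bf fg_le; have PF := sfun_uniform_nbhs_proper bf.
have M_ge0 := charge_bound_ge0.
apply/ler_addgt0Pr => eps eps_gt0.
(* A simple [g'] within [t] of [f], whose integral is within [t] of the limit,
   gives the bound up to an excess of [t + 2 * M * t <= eps]. *)
pose t := eps / (4 * M + 1).
have t_gt0 : 0 < t by apply: divr_gt0 => //; lra.
have /cvgrPdist_le/(_ _ t_gt0) cvg_t := radon_integral_cvg bf.
have near_t : sfun_uniform_nbhs f
  [set g : {sfun X >-> R} | forall x, `|f x - g x| <= t] by exists t.
have [g' [/= L_le g'_le]] := filter_ex (filterI cvg_t near_t).
have gg'_le : `|fine (sintegral (EFin \o mu) g') -
    fine (sintegral (EFin \o mu) g)| <= 2 * M * (t + e).
  apply: sintegral_dist_le => x.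
  rewrite (_ : g' x - g x = (f x - g x) - (f x - g' x)); last by ring.
  by have := ler_normB (f x - g x) (f x - g' x);
     have := fg_le x; have := g'_le x; lra.
have -> : eps = (4 * M + 1) * t by rewrite /t; field; lra.
have := ler_distD (fine (sintegral (EFin \o mu) g')) (radon_integral mu f)
  (fine (sintegral (EFin \o mu) g)).
have : 0 <= M * t by apply: mulr_ge0 => //; exact: ltW.
lra.
Qed.

Lemma radon_integralD (f g : X -> R) :
  bounded_measurable f -> bounded_measurable g ->
  bounded_measurable (f \+ g) ->
  radon_integral mu (f \+ g) = radon_integral mu f + radon_integral mu g.
Proof.
move=> bf bg bfg; have M_ge0 := charge_bound_ge0; apply/eqP.
rewrite -subr_eq0 -normr_le0; apply/ler_addgt0Pr => eps eps_gt0; rewrite add0r.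
(* Three approximations cost [2 * M * e] each, and additivity for the simple
   functions, which is off by at most [3 * e] pointwise, costs [6 * M * e]. *)
pose e := eps / (12 * M + 1).
have e_gt0 : 0 < e by apply: divr_gt0 => //; lra.
have [f' f'_le] := sfun_uniform_approx bf e_gt0.
have [g' g'_le] := sfun_uniform_approx bg e_gt0.
have [k' k'_le] := sfun_uniform_approx bfg e_gt0.
have := radon_integral_dist_le bf f'_le.
have := radon_integral_dist_le bg g'_le.
have := radon_integral_dist_le bfg k'_le.
have : `|fine (sintegral (EFin \o mu) f') + fine (sintegral (EFin \o mu) g')
    - fine (sintegral (EFin \o mu) k')| <= 2 * M * (3 * e).
  apply: sintegral_addB_le => x; move: (f'_le x) (g'_le x) (k'_le x) => /=.
  by rewrite !ler_norml => /andP[? ?] /andP[? ?] /andP[? ?];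
     apply/andP; split; lra.
have -> : eps = (12 * M + 1) * e by rewrite /e; field; lra.
by rewrite !ler_norml => /andP[? ?] /andP[? ?] /andP[? ?] /andP[? ?];
   apply/andP; split; lra.
Qed.

Lemma radon_integral_le (f : X -> R) (c : R) : bounded_measurable f ->
  (forall x, `|f x| <= c) -> `|radon_integral mu f| <= 2 * M * c.
Proof.
move=> bf f_le; rewrite -[radon_integral mu f]subr0.
rewrite -sintegral_sfun0; apply: radon_integral_dist_le => // x.
by rewrite sfun0 subr0.
Qed.

End bounded_charge.

(** * Pure finite additivity on a discrete space *)

Section discrete.
Context (R : realType) (d : measure_display) (X : measurableType d).
Local Open Scope ring_scope.
Hypothesis hX : arbitrary_discrete_space X R.

Let mX (E : set X) : measurable E := discrete_sigma_algebra hX E.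

(** Immeasurability, transported from extended real measures to real-valued
set functions. *)
Lemma ca_ge0_eq0 (lam : set X -> R) : ca lam ->
  le_on_measurable (fun=> 0) lam -> (forall y, lam [set y] = 0) ->
  forall E, lam E = 0.
Proof.
move=> [[lam0 _ _] lam_sigma] lam_ge0 lam1 E.
have lamE_ge0 A : (0 <= (EFin \o lam) A)%E by rewrite lee_fin lam_ge0.
have lamE0 : (EFin \o lam) set0 = 0%E by rewrite /= lam0.
have lam_ssigma : semi_sigma_additive (EFin \o lam).
  by move=> F mF tF _; exact: lam_sigma.
pose m : {measure set X -> \bar R} := HB.pack (EFin \o lam)
  (isMeasure.Build d X R (EFin \o lam) lamE0 lamE_ge0 lam_ssigma).
have fin_m : fin_num_fun m by [].
pose n : {finite_measure set X -> \bar R} := HB.pack (EFin \o lam)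
  m (Measure_isFinite.Build d X R m fin_m).
have n1 x : n [set x] = 0%E by rewrite /= lam1.
by have [] := discrete_immeasurable hX n1 (mX E).
Qed.

Lemma jordan_set1 (mu : set X -> R) (y : X) :
  mu set0 = 0 -> mu [set y] = 0 ->
  jordan_plus mu [set y] = 0 /\ jordan_minus mu [set y] = 0.
Proof.
move=> mu0 mu1; rewrite /jordan_plus /jordan_minus.
have -> : [set mu F | F in [set F | measurable F /\ F `<=` [set y]]] = [set 0].
  apply/seteqP; split => [_ [F [_ /subset_set1[->|->]] <-]|_ ->] //=.
  by exists set0 => //; split.
by rewrite sup1 inf1 oppr0.
Qed.

(** This is where immeasurability enters: a countably additive minorant of
either Jordan part vanishes at every point, hence everywhere. *)
Lemma pfa_set1_eq0 (mu : set X -> R) :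
  ba mu -> (forall y, mu [set y] = 0) -> pfa mu.
Proof.
move=> bmu mu1; have [mu0 _ _] := bmu.
split=> // lam clam lam_ge0 lam_le E _; apply: ca_ge0_eq0 => // y;
  apply/eqP; rewrite eq_le lam_ge0 // andbT.
- by have [<- _] := jordan_set1 mu0 (mu1 y); exact: lam_le.
- by have [_ <-] := jordan_set1 mu0 (mu1 y); exact: lam_le.
Qed.

(** The point mass that [mu] puts at [y] is countably additive and lies below
[mu], so purity forces it to vanish. *)
Lemma pfa_ge0_set1 (mu : set X -> R) (y : X) :
  pfa mu -> (forall E, 0 <= mu E) -> mu [set y] = 0.
Proof.
move=> [[mu0 muU [M muM]] pure _] mu_ge0.
pose m := mscale (NngNum (mu_ge0 [set y])) (@dirac _ X y R).
pose lam E := fine (m E).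
have lamE E : lam E = mu [set y] * \1_E y.
  by rewrite /lam /m /mscale /dirac.
have mE : EFin \o lam = m.
  by apply/funext => E; rewrite /= lamE.
have lam1 : lam [set y] = mu [set y] by rewrite lamE indicE mem_set // mulr1.
rewrite -lam1; apply: pure => //.
- split; last first.
    rewrite mE => F mF tF; apply: measure_semi_sigma_additive => //.
  split; first by rewrite lamE indic0 mulr0.
    by rewrite mE => A B mA mB AB; exact: measureU.
  exists (mu [set y]) => E _.
  rewrite lamE ger0_norm ?mulr_ge0 // ler_piMr // indicE; by case: (_ \in _).
- by move=> E _; rewrite lamE; apply: mulr_ge0; rewrite ?indicE ?ler0n.
move=> E _; rewrite lamE /jordan_plus; apply: sup_upper_bound.
  split; first by exists 0; exists set0 => //; split.
  exists M => _ [F [mF _] <-]; apply: le_trans (muM F mF); exact: ler_norm.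
rewrite indicE; have [yE|yE] := boolP (y \in E).
  by rewrite mulr1; exists [set y] => //; split => // _ ->; exact: set_mem.
by rewrite mulr0; exists set0 => //; split.
Qed.

(** * The operator *)

Lemma sub_Markov_operator_pfa (P : X -> set X -> R) (mu : set X -> R) :
  pfa_sub_Markov_kernel P -> ba mu -> pfa (sub_Markov_operator P mu).
Proof.
move=> [P01 bP pfaP] [mu0 muU [M mu_le]].
have P_ge0 x E : 0 <= P x E by have /andP[] := P01 x E (mX E).
have P_le1 x E : `|P x E| <= 1.
  by rewrite ger0_norm //; have /andP[] := P01 x E (mX E).
have int0 E : (forall x, P x E = 0) -> sub_Markov_operator P mu E = 0.
  move=> PE0; apply/eqP; rewrite -normr_le0 -(mulr0 (2 * M)).
  apply: (radon_integral_le mu0 muU mu_le) => [|x]; first exact: bP.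
  by rewrite PE0 normr0.
apply: pfa_set1_eq0 => [|y]; last first.
  by apply: int0 => x; apply: pfa_ge0_set1.
split; first by apply: int0 => x; have [[]] := pfaP x.
  move=> A B mA mB AB; rewrite /= -EFinD; congr EFin.
  have PU : P ^~ (A `|` B) = P ^~ A \+ P ^~ B.
    apply/funext => x; have [[_ PxU _] _ _] := pfaP x.
    by have [] := PxU A B mA mB AB.
  rewrite /sub_Markov_operator PU.
  apply: (radon_integralD mu0 muU mu_le); try exact: bP.
  by rewrite -PU; exact: bP.
exists (2 * M * 1) => E mE.
by apply: (radon_integral_le mu0 muU mu_le) => //; exact: bP.
Qed.

End discrete.

Theorem theorem3p5 (R : realType) (d : measure_display) (X : measurableType d)
    (hX : arbitrary_discrete_space X R)
    (P : X -> set X -> R) (hP : pfa_sub_Markov_kernel P) :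
  [/\ sub_Markov_operator P @` ba `<=` pfa,
      sub_Markov_operator P @` ca `<=` pfa &
      sub_Markov_operator P @` pfa `<=` pfa].
Proof.
have ba_pfa mu : ba mu -> pfa (sub_Markov_operator P mu).
  exact: sub_Markov_operator_pfa.
by split=> _ [mu mu_in <-]; apply: ba_pfa; case: mu_in.
Qed.
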